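(* Let $(\Gamma,\mu)$ be a weighted graph satisfying $(p_0)$, $(VD)$ and $(TC)$, that is: (i) there is $p_0>0$ with $\mu_{x,y}/\mu(x)\ge p_0$ for all adjacent $x\sim y$; (ii) there is $D_V>0$ with $V(x,2R)\le D_V V(x,R)$ for all $x\in\Gamma$, $R>0$; (iii) there is $C_T>1$ with $E(x,2R)\le C_T\,E(y,R)$ for all $x\in\Gamma$, $R>0$, $y\in B(x,R)$. Then the Einstein relation $E(x,2R)\simeq\rho(x,R,2R)\,v(x,R,2R)$ holds, that is, there is a constant $C>1$ such that for all $x\in\Gamma$ and $R>0$ $$C^{-1}\rho(x,R,2R)\,v(x,R,2R)\le E(x,2R)\le C\,\rho(x,R,2R)\,v(x,R,2R).$$
   Context: $\Gamma$ is a countably infinite connected graph ($x\sim y$ denotes adjacency) with weights $\mu_{x,y}=\mu_{y,x}>0$ on its edges ($\mu_{x,y}=0$ if $x\not\sim y$); $\mu(x)=\sum_{y\sim x}\mu_{x,y}$ and $\mu(A)=\sum_{y\in A}\mu(y)$. $X_n$ is the random walk with transition probabilities $P(x,y)=\mu_{x,y}/\mu(x)$. $d$ is the shortest-path distance, $B(x,R)=\{y: d(x,y)<R\}$, $V(x,R)=\mu(B(x,R))$, and $v(x,r,R)=V(x,R)-V(x,r)$. $T_A=\min\{k: X_k\in\Gamma\setminus A\}$ and $E(x,R)=\mathbb{E}(T_{B(x,R)}\mid X_0=x)$. $Pf(x)=\sum_yP(x,y)f(y)$, $\Delta=P-I$ and $(f,g)_\mu=\sum_x f(x)g(x)\mu(x)$.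 The resistance between disjoint sets $A,B$ is $\rho(A,B)=\left(\inf\{(-\Delta f,f)_\mu: f|_A=1,\ f|_B=0\}\right)^{-1}$; and $\rho(x,r,R)=\rho(B(x,r),\Gamma\setminus B(x,R))$.
   Formalization: The Einstein relation is stated for all real R > 1/2 instead of R > 0: for 0 < R ≤ 1/2 both B(x,R) and B(x,2R) equal {x}, so v(x,R,2R) = 0 and ρ is finite while E(x,2R) ≥ 1, and the upper bound fails for every C. *)

(* Defs.v *)
From HB Require Import structures.
From mathcomp Require Import all_boot all_order all_algebra.
From mathcomp Require Import all_classical all_reals all_analysis.

Set Implicit Arguments.
Unset Strict Implicit.
Unset Printing Implicit Defensive.

Import Order.TTheory GRing.Theory Num.Theory.
Import numFieldNormedType.Exports.

Local Open Scope classical_set_scope.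
Local Open Scope ring_scope.

(* Loops are neither required nor excluded. *)
Record weighted_graph (R : realType) (V : countType) := WeightedGraph {
  adj : rel V;
  adj_sym : symmetric adj;
  vertices_infinite : infinite_set [set: V];
  adj_connected : forall x y, exists p, path adj x p /\ last x p = y;
  weight : V -> V -> R;
  weight_sym : forall x y, weight x y = weight y x;
  weight_gt0 : forall x y, adj x y -> 0 < weight x y;
  weight_eq0 : forall x y, ~~ adj x y -> weight x y = 0 }.

Section WeightedGraphs.
Variables (R : realType) (V : countType) (G : weighted_graph R V).
Implicit Types (x y : V) (A B : set V) (r s : R) (f g : V -> R).

Lemma walk_of_some_length x y :
  exists n, `[< exists p, [/\ path (adj G) x p, last x p = y & size p = n] >].
Proof.
by have [p [xp py]] := adj_connected G x y; exists (size p); apply/asboolP; exists p.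
Qed.

Definition gdist x y : nat := ex_minn (walk_of_some_length x y).

Definition gball x r : set V := [set y | (gdist x y)%:R < r].

(* No local finiteness is assumed here: it follows from (p_0). If the sum
   diverged, [fine] would make [mass x], hence every [trans x y], equal to 0
   (as [a / 0 = 0]), which (p_0) excludes. *)
Definition mass x : R := fine (\esum_(y in [set y | adj G x y]) (weight G x y)%:E).

Definition massS A : \bar R := \esum_(y in A) (mass y)%:E.

Definition vol x r : \bar R := massS (gball x r).

Definition annulus_vol x r s : \bar R := (vol x s - vol x r)%E.

Definition trans x y : R := weight G x y / mass x.

(* Sum over all vertices of a function of arbitrary sign; meaningful when the
   sum converges absolutely. *)
Definition vsum f : \bar R :=
  (\esum_(x in [set: V]) (f^\+ x)%:E - \esum_(x in [set: V]) (f^\- x)%:E)%E.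

Definition Pop f : V -> R := fun x => fine (vsum (fun y => trans x y * f y)).

Definition laplacian f : V -> R := fun x => Pop f x - f x.

Definition inner_mu f g : \bar R := vsum (fun x => f x * g x * mass x).

(* The infimum ranges over those f for which (-Delta f, f)_mu converges. Under
   (p_0) this is no restriction when the complement of B is finite, as it is for
   [annulus_resistance]. *)
Definition resistance A B : \bar R :=
  inve (ereal_inf [set inner_mu (\- laplacian f) f | f in
    [set f : V -> R | [/\ forall x, A x -> f x = 1, forall x, B x -> f x = 0 &
      summable [set: V] (fun x => (- laplacian f x * f x * mass x)%:E)]]]).

Definition annulus_resistance x r s : \bar R :=
  resistance (gball x r) (~` gball x s).

Definition random_walk_from d (Omega : measurableType d)
    (Pr : probability Omega R) (X : nat -> Omega -> V) x : Prop :=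
  [/\ forall n y, measurable (X n @^-1` [set y]),
      Pr [set w | X 0%N w = x] = 1%E &
      forall (p : nat -> V) (n : nat),
        Pr [set w | forall i, (i <= n.+1)%N -> X i w = p i] =
        (Pr [set w | forall i, (i <= n)%N -> X i w = p i] *
           (trans (p n) (p n.+1))%:E)%E].

(* The infimum is a minimum, except that it is +oo if the walk stays in A. *)
Definition exit_time (Omega : Type) (X : nat -> Omega -> V) A (w : Omega) : \bar R :=
  ereal_inf [set k%:R%:E | k in [set k | (~` A) (X k w)]].

(* [Pr x] is the law of the walk conditioned on X_0 = x. *)
Definition mean_exit_time d (Omega : measurableType d)
    (Pr : V -> probability Omega R) (X : nat -> Omega -> V) x r : \bar R :=
  (\int[Pr x]_(w in [set: Omega]) exit_time X (gball x r) w)%E.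

Definition cond_p0 : Prop :=
  exists p0 : R, 0 < p0 /\ forall x y, adj G x y -> p0 <= weight G x y / mass x.

Definition cond_VD : Prop :=
  exists D : R, 0 < D /\
    forall x r, 0 < r -> (vol x (2 * r) <= D%:E * vol x r)%E.

Definition cond_TC d (Omega : measurableType d)
    (Pr : V -> probability Omega R) (X : nat -> Omega -> V) : Prop :=
  exists C : R, 1 < C /\
    forall x r, 0 < r -> forall y, gball x r y ->
      (mean_exit_time Pr X x (2 * r) <= C%:E * mean_exit_time Pr X y r)%E.

End WeightedGraphs.

(* Main.v *)
Require Import Defs.
From mathcomp Require Import all_boot all_order all_algebra.
From mathcomp Require Import all_classical all_reals all_analysis.
From mathcomp Require Import measurable_realfun finmap zify lra.

(* Let A = B(x,r), B = B(x,2r), let h be the equilibrium potential of A in B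
   (h = 1 on A, harmonic in B \ A, 0 off B), e = mu (-Delta h) >= 0 its charge,
   carried by A and of total mass cap = 1/rho, and u(y) the mean exit time from
   B started at y, so that -Delta u = 1 in B.  Green's formula gives
     sum_A e u = (h, -Delta u)_mu = (h, 1)_mu, which lies between V(x,r) and
   V(x,2r).
   By (TC), u is comparable to E(x,2r) on A, since B(y,r) is contained in B and
   B in B(y,4r); hence E(x,2r) is comparable to rho (h, 1)_mu.  By (VD) both
   V(x,r) and V(x,2r) are comparable to v(x,r,2r), because the annulus contains
   a ball of radius r/4.  All balls being finite by (p_0), h is the increasing
   limit of the iterates of f |-> 1 on A, P f on B \ A, 0 off B. *)

Set Implicit Arguments.
Unset Strict Implicit.
Unset Printing Implicit Defensive.

Import Order.TTheory GRing.Theory Num.Theory.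
Import numFieldNormedType.Exports.

Local Open Scope classical_set_scope.
Local Open Scope ring_scope.

(** * Sums of finitely supported functions *)

Section FiniteSums.
Variables (R : realType) (V : countType).

Lemma esum_seq (A : set V) (s : seq V) (f : V -> R) : A = [set` s] -> uniq s ->
  (forall x, 0 <= f x) ->
  (\esum_(x in A) (f x)%:E)%E = (\sum_(x <- s) f x)%:E.
Proof.
move=> -> us f0; rewrite esum_fset; first last.
- by move=> i _; rewrite lee_fin.
- exact: finite_seq.
by rewrite -fsbig_seq// sumEFin.
Qed.

Lemma esum_support (s : seq V) (f : V -> R) : uniq s ->
  (forall x, 0 <= f x) -> (forall x, x \notin s -> f x = 0) ->
  (\esum_(x in [set: V]) (f x)%:E)%E = (\sum_(x <- s) f x)%:E.
Proof.
move=> us f0 fs; rewrite -(esum_seq erefl us f0) [RHS]esum_mkcond.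
apply: eq_esum => x _; case: ifPn => //; rewrite notin_setE/= => /negP xs.
by rewrite fs.
Qed.

(** Lets the sums behind the Laplacian and the inner product be computed over the enumeration of a
    ball, once the function vanishes off that ball. *)
Lemma vsum_support (s : seq V) (f : V -> R) : uniq s ->
  (forall x, x \notin s -> f x = 0) -> vsum f = (\sum_(x <- s) f x)%:E.
Proof.
move=> us fs; rewrite /vsum (esum_support us) ?(esum_support (s := s) us).
- rewrite -EFinB -sumrB; congr (_%:E); apply: eq_bigr => x _.
  exact: (congr1 (@^~ x) (funrposBneg f)).
- by move=> x; exact: funrneg_ge0.
- by move=> x xs; rewrite /funrneg fs// oppr0 maxxx.
- by move=> x; exact: funrpos_ge0.
- by move=> x xs; rewrite /funrpos fs// maxxx.
Qed.

Lemma summable_support (s : seq V) (f : V -> R) : uniq s ->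
  (forall x, x \notin s -> f x = 0) -> summable [set: V] (fun x => (f x)%:E).
Proof.
move=> us fs; rewrite /summable/= (esum_support (f := fun x => `|f x|) us).
- exact: ltry.
- by [].
- by move=> x xs; rewrite fs ?normr0.
Qed.

End FiniteSums.

(** * Graph distance, balls and connectedness *)

Section Distance.
Variables (R : realType) (V : countType) (G : weighted_graph R V).
Implicit Types (x y z : V).

Lemma gdist_le x y p : path (adj G) x p -> last x p = y ->
  (gdist G x y <= size p)%N.
Proof.
move=> xp py; rewrite /gdist; case: ex_minnP => n _; apply.
by apply/asboolP; exists p.
Qed.

Lemma gdist_geodesic x y :
  exists p, [/\ path (adj G) x p, last x p = y & size p = gdist G x y].
Proof. by rewrite /gdist; case: ex_minnP => n /asboolP. Qed.

Lemma gdistxx x : gdist G x x = 0%N.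
Proof. by apply/eqP; rewrite -leqn0; apply: (@gdist_le x x [::]). Qed.

Lemma gdist_eq0 x y : gdist G x y = 0%N -> x = y.
Proof.
have [p [_ <- ps]] := gdist_geodesic x y.
by rewrite -ps; case: p {ps}.
Qed.

Lemma gdist_triangle x y z :
  (gdist G x z <= gdist G x y + gdist G y z)%N.
Proof.
have [p [xp py <-]] := gdist_geodesic x y.
have [q [yq qz <-]] := gdist_geodesic y z.
by rewrite -size_cat; apply: gdist_le; rewrite ?last_cat ?cat_path py ?xp.
Qed.

Lemma gdist_sym x y : gdist G x y = gdist G y x.
Proof.
suff le u v : (gdist G v u <= gdist G u v)%N by apply/eqP; rewrite eqn_leq !le.
have [p [up pv <-]] := gdist_geodesic u v.
rewrite -pv -(size_belast u) -size_rev; apply: gdist_le.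
  rewrite -rev_path in up; apply: sub_path up => a b.
  by rewrite (adj_sym G).
by case: p {up pv} => //= a p; rewrite rev_cons last_rcons.
Qed.

Lemma gdist_adj x y z : adj G y z -> (gdist G x z <= (gdist G x y).+1)%N.
Proof.
move=> yz; apply: leq_trans (gdist_triangle x y z) _.
by rewrite -addn1 leq_add2l; apply: (@gdist_le y z [:: z]) => //=; rewrite yz.
Qed.

Lemma gball_center x (r : R) : 0 < r -> gball G x r x.
Proof. by rewrite /gball/= gdistxx. Qed.

Lemma gball_sym x y (r : R) : gball G x r y -> gball G y r x.
Proof. by rewrite /gball/= gdist_sym. Qed.

Lemma sub_gball x (r s : R) : r <= s -> gball G x r `<=` gball G x s.
Proof. by move=> rs y /lt_le_trans; apply. Qed.

Lemma gball_triangle x y (r s : R) : gball G x r y ->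
  gball G y s `<=` gball G x (r + s).
Proof.
move=> xy z yz; rewrite /gball/=.
apply: le_lt_trans (ltrD xy yz); rewrite -natrD ler_nat.
exact: gdist_triangle.
Qed.

Lemma gball_le1 x (r : R) : r <= 1 -> gball G x r `<=` [set x].
Proof.
move=> r1 y xy; symmetry; apply: gdist_eq0; apply/eqP.
by rewrite -leqn0 -ltnS -(ltr_nat R); exact: lt_le_trans xy r1.
Qed.

(** Connectedness as an induction principle along edges. *)
Lemma adj_ind (P : V -> Prop) x : P x ->
  (forall y z, adj G y z -> P y -> P z) -> forall z, P z.
Proof.
move=> Px Padj z; have [p [xp <-]] := adj_connected G x z.
elim: p x Px xp => //= a p IH x Px /andP[xa ap].
exact: IH (Padj _ _ xa Px) ap.
Qed.

(** A vertex without neighbours would be the whole connected graph, which is infinite. *)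
Lemma exists_adj x : exists y, adj G x y.
Proof.
have [//|/forallNP noadj] := pselect (exists y, adj G x y).
case: (vertices_infinite G); suff -> : [set: V] = [set x] by exact: finite_set1.
apply/seteqP; split => // z _ /=.
have [[|a p] [/= xp <-]] := adj_connected G x z; first by [].
by case/andP: xp => /(noadj a).
Qed.

End Distance.

(** * Consequences of $(p_0)$ and $(VD)$: finite balls, volume of annuli *)

Section BoundedGeometry.
Variables (R : realType) (V : countType) (G : weighted_graph R V).
Variables (p0 : R) (p0_gt0 : 0 < p0).
Hypothesis p0_trans : forall x y, adj G x y -> p0 <= weight G x y / mass G x.
Implicit Types (x y z : V).

Lemma weight_ge0 x y : 0 <= weight G x y.
Proof.
by have [/weight_gt0/ltW//|/weight_eq0->] := boolP (adj G x y).
Qed.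

(** The ratio in $(p_0)$ is positive for some neighbour, which rules out [mass G x] being 0, the
    default value of [fine] on a divergent sum. *)
Lemma mass_gt0 x : 0 < mass G x.
Proof.
have [y xy] := exists_adj G x.
have := lt_le_trans p0_gt0 (p0_trans xy).
by rewrite pmulr_rgt0 ?invr_gt0// weight_gt0.
Qed.

Lemma esum_weight x :
  (\esum_(y in [set y | adj G x y]) (weight G x y)%:E)%E = (mass G x)%:E.
Proof.
have := mass_gt0 x; rewrite /mass.
set e := esum _ _; have : (0 <= e)%E.
  by apply: esum_ge0 => y _; rewrite lee_fin weight_ge0.
by case: e => //=; rewrite ltxx.
Qed.

Lemma sum_weight_le x (s : seq V) : uniq s ->
  \sum_(y <- s) weight G x y <= mass G x.
Proof.
move=> us; rewrite -lee_fin -esum_weight.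
rewrite (bigID (fun y => adj G x y))/= [X in _ + X]big1 ?addr0; last first.
  by move=> y /weight_eq0.
rewrite -big_filter; apply: esum_ge; exists [set` [seq y <- s | adj G x y]].
  split; first exact: finite_seq.
  by move=> y /=; rewrite mem_filter => /andP[].
by rewrite -fsbig_seq ?filter_uniq// sumEFin.
Qed.

(** Each neighbour carries at least the fraction [p0] of [mass G x], so there are at most 1/[p0] of
    them. *)
Lemma finite_neighbours x : finite_set [set y | adj G x y].
Proof.
have [//|/infinite_set_fset inf] := pselect (finite_set [set y | adj G x y]).
have [n pn] : exists n, p0^-1 < n%:R.
  by exists (Num.truncn p0^-1).+1; exact: truncnS_gt.
have [C Cadj nC] := inf n.
have := @sum_weight_le x (enum_fset C) (fset_uniq C).
have : \sum_(y <- enum_fset C) (p0 * mass G x) <=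
    \sum_(y <- enum_fset C) weight G x y.
  rewrite big_seq [leRHS]big_seq; apply: ler_sum => y yC.
  by rewrite -ler_pdivlMr ?mass_gt0// p0_trans//; exact: Cadj.
move=> /le_trans /[apply]; rewrite big_const_seq count_predT iter_addr_0.
rewrite -mulr_natl mulrA ger_pMl ?mass_gt0// leNgt => /negP[].
rewrite -(ltr_pdivrMr _ _ p0_gt0) mul1r (lt_le_trans pn)// ler_nat//.
Qed.

Lemma finite_gball_nat x n : finite_set [set y | (gdist G x y <= n)%N].
Proof.
elim: n => [|n IH].
  apply: sub_finite_set (finite_set1 x) => y /=.
  by rewrite leqn0 => /eqP /gdist_eq0.
apply: sub_finite_set (_ : finite_set ([set x] `|`
    \bigcup_(z in [set z | (gdist G x z <= n)%N]) [set y | adj G z y])).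
  move=> y /=; have [p [xp <- <-]] := gdist_geodesic G x y.
  case/lastP: p xp => [|p z]; first by left.
  rewrite rcons_path last_rcons size_rcons ltnS => /andP[xp zp] pn; right.
  by exists (last x p) => //=; apply: leq_trans pn; exact: gdist_le.
rewrite finite_setU; split; first exact: finite_set1.
by apply: bigcup_finite => // z _; exact: finite_neighbours.
Qed.

Lemma finite_gball x r : finite_set (gball G x r).
Proof.
apply: sub_finite_set (finite_gball_nat x (Num.truncn r).+1) => y.
rewrite /gball/= => yr; rewrite -(ler_nat R); apply/ltW/(lt_trans yr).
exact: truncnS_gt.
Qed.

Lemma gball_seq x r : exists s : seq V, uniq s /\ gball G x r = [set` s].
Proof.
have /finite_seqP[s ->] := finite_gball x r.
exists (undup s); split; first exact: undup_uniq.
by apply/seteqP; split => y /=; rewrite mem_undup.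
Qed.

Lemma vol_seq x r s : gball G x r = [set` s] -> uniq s ->
  vol G x r = (\sum_(y <- s) mass G y)%:E.
Proof. by move=> /esum_seq E us; apply: E => // y; exact/ltW/mass_gt0. Qed.

Lemma vol_fin_num x r : vol G x r \is a fin_num.
Proof. by have [s [us /vol_seq->]] := gball_seq x r. Qed.

Lemma sub_massS A B : A `<=` B -> (massS G A <= massS G B)%E.
Proof.
move=> AB; rewrite /massS (esum_mkcond A) (esum_mkcond B); apply: le_esum => y _.
case: ifPn => [/set_mem/AB/mem_set->//|_].
by case: ifPn => // _; rewrite lee_fin ltW ?mass_gt0.
Qed.

(** Along an edge the distance to [x] grows by at most 1, so it cannot jump over [n]; if the value
    [n] were missed, the whole graph would lie in a finite ball. *)
Lemma exists_gdist x n : exists y, gdist G x y = n.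
Proof.
have [//|/forallNP noy] := pselect (exists y, gdist G x y = n).
case: (vertices_infinite G).
apply: sub_finite_set (finite_gball_nat x n) => z _ /=.
apply: ltnW; move: z; apply: (adj_ind (G := G) (x := x)) => [|y z yz yn].
  by rewrite gdistxx lt0n; apply/eqP => n0; apply: (noy x); rewrite gdistxx.
rewrite ltn_neqAle; apply/andP; split; first exact/eqP/noy.
exact: leq_trans (gdist_adj x yz) yn.
Qed.

(* A quarter-radius ball sits inside the annulus; when [r <= 4] that ball is a
   single vertex, so that any vertex of the annulus will do. *)
Lemma annulus_ball x r : 2^-1 < r -> exists y, gball G x (2 * r) y /\
  gball G y (r / 4) `<=` gball G x (2 * r) `\` gball G x r.
Proof.
move=> r2; have [r4|r4] := leP r 4.
  (* The interval [r, 2r) contains an integer because r > 1/2. *)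
  have [k /andP[rk kr]] : exists k : nat, r <= k%:R < 2 * r.
    have [r1|r1] := leP r 1; first by exists 1%N; lra.
    exists (Num.truncn r).+1; rewrite ltW ?truncnS_gt//=.
    rewrite -addn1 natrD; have : (Num.truncn r)%:R <= r by rewrite truncn_le; lra.
    lra.
  have [y yk] := exists_gdist x k.
  exists y; split; first by rewrite /gball/= yk; lra.
  move=> z /(gball_le1 _) -> //; last lra.
  by split; rewrite /gball/= yk; lra.
(* The centre is taken at distance [k] in (5r/4, 5r/4 + 1]: beyond r + r/4, and below 2r - r/4 since
   r > 4. *)
pose k := (Num.truncn (5 * r / 4)).+1.
have k1 : 5 * r / 4 < k%:R by exact: truncnS_gt.
have k2 : k%:R <= 5 * r / 4 + 1.
  by rewrite /k -addn1 natrD lerD2r truncn_le//; lra.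
have [y yk] := exists_gdist x k.
exists y; split; first by rewrite /gball/= yk; lra.
move=> z yz; split.
  have : gball G x (2 * r - r / 4 + r / 4) z.
    apply: (gball_triangle _ yz); rewrite /gball/= yk; lra.
  by rewrite subrK.
move=> xz; have := gball_triangle xz (gball_sym yz).
by rewrite /gball/= yk; lra.
Qed.

Lemma annulus_vol_massS x r : 0 < r ->
  annulus_vol G x r (2 * r) = massS G (gball G x (2 * r) `\` gball G x r).
Proof.
move=> r0; have rr : gball G x r `<=` gball G x (2 * r) by apply: sub_gball; lra.
rewrite /annulus_vol {1}/vol /massS (esumID (gball G x r)); last first.
  by move=> y _; rewrite lee_fin ltW ?mass_gt0.
rewrite setIidr// addeAC subee ?add0e//; exact: vol_fin_num.
Qed.

(** With [y] the centre of the small ball in the annulus, B(x,2r) lies in B(y,4r); the exponent 4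
    counts the doublings from r/4 to 4r. *)
Lemma vol_le_annulus (D : R) : 0 < D ->
  (forall x r, 0 < r -> (vol G x (2 * r) <= D%:E * vol G x r)%E) ->
  forall x r, 2^-1 < r ->
  (vol G x (2 * r) <= (D ^+ 4)%:E * annulus_vol G x r (2 * r))%E.
Proof.
move=> D0 VD x r r2; have r0 : 0 < r by lra.
have [y [xy yA]] := annulus_ball x r2.
rewrite annulus_vol_massS//.
have VDD t : 0 < t -> (vol G y (2 * t) <= D%:E * vol G y t)%E by exact: VD.
have step t u k : 0 < t -> u = 2 * t ->
    (vol G y t <= (D ^+ k)%:E * vol G y (r / 4))%E ->
    (vol G y u <= (D ^+ k.+1)%:E * vol G y (r / 4))%E.
  move=> t0 -> IH; apply: (le_trans (VDD t t0)).
  by rewrite exprS EFinM -muleA lee_pmul2l ?fin_numE// lte_fin.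
apply: (@le_trans _ _ (vol G y (2 * (2 * r)))).
  apply: sub_massS => z /(gball_triangle (gball_sym xy)).
  by rewrite [in X in _ -> X]mulr_natl mulr2n.
apply: (@le_trans _ _ ((D ^+ 4)%:E * vol G y (r / 4))%E); last first.
  by rewrite lee_pmul2l ?fin_numE ?lte_fin ?exprn_gt0//; exact: sub_massS.
apply: (step (2 * r)) => //; first by lra.
apply: (step r) => //; apply: (step (r / 2)); [lra|lra|].
apply: (step (r / 4)); [lra|lra|].
by rewrite expr0 mul1e.
Qed.

End BoundedGeometry.

(** * Dirichlet operator and form on a finite set, maximum principle *)

Section Dirichlet.
Variables (R : realType) (V : countType) (G : weighted_graph R V).
Variables (p0 : R) (p0_gt0 : 0 < p0).
Hypothesis p0_trans : forall x y, adj G x y -> p0 <= weight G x y / mass G x.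
Implicit Types (x y z : V) (f g : V -> R).

Let mass_gt0 x : 0 < mass G x. Proof. exact: mass_gt0 p0_gt0 p0_trans x. Qed.

(** The transition operator of the walk killed on leaving [s]. *)
Definition killed_op (s : seq V) f x : R :=
  if x \in s then \sum_(y <- s) trans G x y * f y else 0.

(** This is $\mu(x)(-\Delta f)(x)$ when [f] vanishes off [s], written with a finite sum. *)
Definition dirichlet_op (s : seq V) f x : R :=
  mass G x * f x - \sum_(y <- s) weight G x y * f y.

Definition dirichlet_form (s : seq V) f g : R :=
  \sum_(x <- s) f x * dirichlet_op s g x.

Lemma mass_trans x y : mass G x * trans G x y = weight G x y.
Proof. by rewrite /trans mulrC divfK// gt_eqF. Qed.

Lemma trans_ge0 x y : 0 <= trans G x y.
Proof. by rewrite /trans divr_ge0 ?weight_ge0// ltW. Qed.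

Lemma killed_op_le s f g : (forall x, f x <= g x) ->
  forall x, killed_op s f x <= killed_op s g x.
Proof.
move=> fg x; rewrite /killed_op; case: ifP => // _.
by apply: ler_sum => y _; rewrite ler_wpM2l ?trans_ge0.
Qed.

Lemma killed_op_le1 s f : uniq s -> (forall x, f x <= 1) ->
  forall x, killed_op s f x <= 1.
Proof.
move=> us f1 x; rewrite /killed_op; case: ifP => // _.
rewrite -(ler_pM2l (mass_gt0 x)) mulr1 mulr_sumr.
apply: le_trans (sum_weight_le p0_gt0 p0_trans x us).
apply: ler_sum => y _; rewrite mulrA mass_trans.
by rewrite ler_piMr ?weight_ge0.
Qed.

Lemma dirichlet_opE s f x : x \in s ->
  dirichlet_op s f x = mass G x * (f x - killed_op s f x).
Proof.
move=> xs; rewrite /dirichlet_op /killed_op xs mulrBr; congr (_ - _).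
by rewrite mulr_sumr; apply: eq_bigr => y _; rewrite mulrA mass_trans.
Qed.

Lemma dirichlet_opB s f g x :
  dirichlet_op s (f \- g) x = dirichlet_op s f x - dirichlet_op s g x.
Proof.
rewrite /dirichlet_op [\sum_(y <- s) _](eq_bigr (fun y =>
  weight G x y * f y - weight G x y * g y)) => [|y _]; last by rewrite mulrBr.
by rewrite sumrB /=; lra.
Qed.

Lemma laplacianE s f x : uniq s -> (forall y, y \notin s -> f y = 0) ->
  - laplacian G f x * mass G x = dirichlet_op s f x.
Proof.
move=> us fs; rewrite /laplacian /Pop (vsum_support us) /=; last first.
  by move=> y /fs ->; rewrite mulr0.
rewrite opprB mulrC mulrBr; congr (_ - _).
by rewrite mulr_sumr; apply: eq_bigr => y _; rewrite mulrA mass_trans.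
Qed.

Lemma inner_mu_laplacian s f : uniq s -> (forall y, y \notin s -> f y = 0) ->
  inner_mu G (\- laplacian G f) f = (dirichlet_form s f f)%:E.
Proof.
move=> us fs; rewrite /inner_mu (vsum_support us) => [|x /fs ->].
  congr (_%:E); apply: eq_bigr => x _.
  by rewrite -(laplacianE x us fs) /=; lra.
by rewrite mulr0 mul0r.
Qed.

(** Green's formula on a finite set, from the symmetry of the weights. *)
Lemma dirichlet_formC s f g : dirichlet_form s f g = dirichlet_form s g f.
Proof.
rewrite /dirichlet_form /dirichlet_op.
under eq_bigr do rewrite mulrBr mulr_sumr.
under [RHS]eq_bigr do rewrite mulrBr mulr_sumr.
rewrite !sumrB; congr (_ - _); first by apply: eq_bigr => x _; lra.
rewrite exchange_big; apply: eq_bigr => x _; apply: eq_bigr => y _.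
by rewrite (weight_sym G x y) /=; lra.
Qed.

(** Bound 2 f(x) f(y) by f(x)^2 + f(y)^2; the weights from a vertex to [s] sum to at most its
    mass. *)
Lemma dirichlet_form_ge0 s f : uniq s -> 0 <= dirichlet_form s f f.
Proof.
move=> us; rewrite /dirichlet_form /dirichlet_op.
under eq_bigr do rewrite mulrBr mulr_sumr.
rewrite sumrB subr_ge0.
have le x : \sum_(y <- s) f x ^+ 2 * weight G x y <= f x * (mass G x * f x).
  rewrite -mulr_sumr [leRHS](_ : _ = f x ^+ 2 * mass G x); last lra.
  by rewrite ler_wpM2l ?sqr_ge0 ?(sum_weight_le p0_gt0 p0_trans).
have le2 : \sum_(x <- s) \sum_(y <- s) f x ^+ 2 * weight G x y <=
  \sum_(x <- s) f x * (mass G x * f x) by exact: ler_sum.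
have le3 : \sum_(x <- s) \sum_(y <- s) f y ^+ 2 * weight G x y <=
    \sum_(x <- s) f x * (mass G x * f x).
  rewrite exchange_big /=; apply: ler_sum => x _; apply: le_trans (le x).
  by apply: ler_sum => y _; rewrite weight_sym.
rewrite -(ler_pM2l (@ltr0n R 2)); apply: le_trans (_ : _ <=
    \sum_(x <- s) \sum_(y <- s) f x ^+ 2 * weight G x y +
    \sum_(x <- s) \sum_(y <- s) f y ^+ 2 * weight G x y) _; last lra.
rewrite -big_split mulr_sumr; apply: ler_sum => x _ /=.
rewrite -big_split mulr_sumr; apply: ler_sum => y _ /=.
rewrite -mulrDl [leLHS](_ : _ = (2 * f x * f y) * weight G x y); last lra.
rewrite ler_wpM2r ?weight_ge0// -subr_ge0.
by rewrite [X in 0 <= X](_ : _ = (f x - f y) ^+ 2) ?sqr_ge0//; lra.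
Qed.

(** At a positive maximum, subharmonicity forces every neighbour to take the same value. By
    connectedness [g] would be a positive constant, yet it vanishes off a finite set. *)
Lemma maximum_principle s g : uniq s -> (forall x, 0 <= g x) ->
  (forall x, x \notin s -> g x = 0) ->
  (forall x, x \in s -> dirichlet_op s g x <= 0) -> forall x, g x = 0.
Proof.
move=> us g0 gs gsub x; apply/eqP; rewrite eq_le g0 andbT leNgt; apply/negP => gx.
have [m [ms gm gmax]] : exists m, [/\ m \in s, 0 < g m & forall y, g y <= g m].
  have xs : x \in s by apply: contraTT gx => /gs ->; rewrite ltxx.
  have [m ms mmax] : exists2 m, m \in s & forall y, y \in s -> g y <= g m.
    elim: (s) x xs {gx} => // a t IH x _; have [->|] := eqVneq t [::].
      by exists a; rewrite ?mem_head// => y; rewrite inE => /eqP ->.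
    case: t IH => // b t IH _; have [m mt mmax] := IH b (mem_head _ _).
    have [am|ma] := leP (g a) (g m).
      exists m; first by rewrite inE mt orbT.
      by move=> y; rewrite inE => /predU1P[->//|]; exact: mmax.
    exists a; rewrite ?mem_head// => y; rewrite inE => /predU1P[->//|/mmax].
    by move=> /le_trans; apply; exact: ltW.
  exists m; split=> //; first exact: lt_le_trans (mmax _ xs).
  by move=> y; have [/mmax//|/gs ->] := boolP (y \in s).
have gconst z : g z = g m.
  move: z; apply: (adj_ind (G := G) (x := m)) => // y z yz gy.
  have ys : y \in s by apply: contraTT gm => /gs; rewrite gy => ->; rewrite ltxx.
  (* The neighbour [z] may lie outside [s]. As [g] vanishes there, adding it leaves the weighted sum
     of [g] unchanged while making the weight of the edge to [z] count. *)
  pose t := if z \in s then s else z :: s.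
  have ut : uniq t by rewrite /t; case: ifPn => // zs /=; rewrite zs.
  have zt : z \in t by rewrite /t; case: ifPn => //; rewrite mem_head.
  have st : \sum_(v <- s) weight G y v * g v = \sum_(v <- t) weight G y v * g v.
    by rewrite /t; case: ifPn => // zs; rewrite big_cons (gs z zs) mulr0 add0r.
  have := gsub y ys; rewrite /dirichlet_op st gy subr_le0 => h1.
  have h2 := ler_wpM2r (ltW gm) (sum_weight_le p0_gt0 p0_trans y ut).
  have : \sum_(v <- t) weight G y v * (g m - g v) <= 0.
    under eq_bigr do rewrite mulrBr.
    by rewrite sumrB -mulr_suml subr_le0; exact: le_trans h1.
  rewrite (bigD1_seq z)//= => h3.
  have : weight G y z * (g m - g z) <= 0.
    apply: le_trans h3; rewrite lerDl; apply: sumr_ge0 => v _.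
    by rewrite mulr_ge0 ?weight_ge0// subr_ge0.
  rewrite pmulr_rle0 ?weight_gt0// subr_le0 => h4.
  by apply/eqP; rewrite eq_le gmax.
case: (vertices_infinite G); apply: sub_finite_set (finite_seq s) => z _ /=.
by apply: contraTT gm => /gs; rewrite gconst => ->; rewrite ltxx.
Qed.

Lemma equilibrium_potential (s a : seq V) : uniq s -> {subset a <= s} ->
  exists h : V -> R, [/\ forall x, 0 <= h x <= 1, forall x, x \in a -> h x = 1,
    forall x, x \notin s -> h x = 0 &
    forall x, x \in s -> x \notin a -> dirichlet_op s h x = 0].
Proof.
move=> us sub_as.
pose T f x := if x \in a then 1 else killed_op s f x.
pose H n := iter n T (fun=> 0).
have T_le f g : (forall x, f x <= g x) -> forall x, T f x <= T g x.
  by move=> fg x; rewrite /T; case: ifP => // _; exact: killed_op_le.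
have H01 n x : 0 <= H n x <= 1.
  elim: n x => [|n IH] x; first by rewrite lexx ler01.
  rewrite /= /T; case: ifP => _; first by rewrite lexx ler01.
  rewrite killed_op_le1 ?andbT => // [|y]; last by case/andP: (IH y).
  rewrite /killed_op; case: ifP => // _; apply: sumr_ge0 => y _.
  by rewrite mulr_ge0 ?trans_ge0//; case/andP: (IH y).
have Hnd x : nondecreasing_seq (H ^~ x).
  apply/nondecreasing_seqP => n; elim: n x => [|n IH] x.
    by have /andP[] := H01 1%N x.
  exact: T_le.
pose h x := limn (H ^~ x).
have Hcvg x : H n x @[n --> \oo] --> h x.
  apply: nondecreasing_is_cvgn => //; exists 1 => _ [n _ <-].
  by have /andP[] := H01 n x.
(* Pass to the limit in [H n.+1 = T (H n)]: the sum over [s] is finite, hence commutes with the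
   limit. *)
have TH x : h x = T h x.
  apply: (@cvg_unique _ _ (H n.+1 x @[n --> \oo])); first exact: norm_hausdorff.
    by have := Hcvg x; rewrite -cvg_shiftS.
  rewrite /= /T; case: ifP => _; first exact: cvg_cst.
  rewrite /killed_op; case: ifP => _; last exact: cvg_cst.
  by apply: cvg_big => [|y _]; [exact: add_continuous | exact: cvgMl_tmp].
exists h; split.
- move=> x; apply/andP; split.
    by apply: limr_ge; [exact: Hcvg|near=> n; case/andP: (H01 n x)].
  by apply: limr_le; [exact: Hcvg|near=> n; case/andP: (H01 n x)].
- by move=> x xa; rewrite TH /T xa.
- move=> x xs; rewrite TH /T /killed_op (negbTE xs) ifF//.
  by apply/negbTE; apply: contra xs => /sub_as.
- move=> x xs xa; rewrite dirichlet_opE// [X in X - _]TH /T (negbTE xa).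
  by rewrite subrr mulr0.
Unshelve. all: by end_near.
Qed.

(** * Equilibrium charge, capacity and resistance *)

Section Capacity.
Variables (s a : seq V) (h : V -> R).
Hypotheses (us : uniq s) (sub_as : {subset a <= s}).
Hypotheses (h01 : forall x, 0 <= h x <= 1) (ha : forall x, x \in a -> h x = 1).
Hypotheses (hs : forall x, x \notin s -> h x = 0)
  (hharm : forall x, x \in s -> x \notin a -> dirichlet_op s h x = 0).

Let e x := dirichlet_op s h x.

(** On [a] the potential equals 1, its maximum, while its killed average is at most 1; off [a] the
    charge is 0. *)
Lemma equilibrium_charge_ge0 x : x \in s -> 0 <= e x.
Proof.
move=> xs; have [xa|xa] := boolP (x \in a); last by rewrite /e hharm.
rewrite /e dirichlet_opE// ha// mulr_ge0 ?(ltW (mass_gt0 x))// subr_ge0.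
by apply: killed_op_le1 => // y; case/andP: (h01 y).
Qed.

Lemma capacityE : dirichlet_form s h h = \sum_(x <- s) e x.
Proof.
rewrite /dirichlet_form !big_seq; apply: eq_bigr => x xs.
have [xa|xa] := boolP (x \in a); first by rewrite ha ?mul1r.
by rewrite /e hharm ?mulr0.
Qed.

(** Otherwise [h] would be subharmonic on all of [s], hence 0 by the maximum principle, against
    [h = 1] on [a]. *)
Lemma equilibrium_charge_gt0 : (exists x, x \in a) ->
  exists2 x, x \in a & 0 < e x.
Proof.
move=> [x xa]; apply: contrapT => /forall2NP noe.
have : h x = 0.
  apply: (maximum_principle (s := s)) => // y; first by case/andP: (h01 y).
  move=> ys; have [ya|ya] := boolP (y \in a); last by rewrite hharm.
  by case: (noe y) => // /negP; rewrite -leNgt.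
by rewrite ha// => /eqP; rewrite oner_eq0.
Qed.

Lemma capacity_gt0 : (exists x, x \in a) -> 0 < dirichlet_form s h h.
Proof.
move=> /equilibrium_charge_gt0[x xa ex]; rewrite capacityE.
rewrite (bigD1_seq x) ?sub_as//= ltr_wpDr// big_seq_cond.
by apply: sumr_ge0 => y /andP[ys _]; exact: equilibrium_charge_ge0.
Qed.

(* Writing [f = h + g], the cross term vanishes because [g] is [0] on [a] and
   [h] is harmonic off [a]. *)
Lemma capacity_min f : (forall x, x \in a -> f x = 1) ->
  (forall x, x \notin s -> f x = 0) ->
  dirichlet_form s h h <= dirichlet_form s f f.
Proof.
move=> fa fs; pose g := f \- h.
have gh : dirichlet_form s g h = 0.
  rewrite /dirichlet_form big_seq big1// => x xs.
  have [xa|xa] := boolP (x \in a); first by rewrite /g /= fa ?ha ?subrr ?mul0r.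
  by rewrite hharm ?mulr0.
have fgh x : dirichlet_op s f x = dirichlet_op s g x + dirichlet_op s h x.
  by rewrite dirichlet_opB subrK.
have -> : dirichlet_form s f f = dirichlet_form s h h + dirichlet_form s g g +
    (dirichlet_form s g h + dirichlet_form s h g).
  rewrite /dirichlet_form -!big_split; apply: eq_bigr => x _ /=.
  by rewrite fgh /g /=; lra.
rewrite (dirichlet_formC s h g) gh !addr0 lerDl.
exact: dirichlet_form_ge0.
Qed.

(** The potential [h] is an admissible competitor and attains the infimum by [capacity_min]; the
    capacity being positive, [inve] is the ordinary inverse. *)
Lemma resistanceE : (exists x, x \in a) ->
  resistance G [set` a] (~` [set` s]) = ((dirichlet_form s h h)^-1)%:E.
Proof.
move=> a0; rewrite /resistance; set I := ereal_inf _.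
suff -> : I = (dirichlet_form s h h)%:E.
  by rewrite /inve gt_eqF ?capacity_gt0.
apply/eqP; rewrite eq_le; apply/andP; split.
  apply: ereal_inf_lbound; exists h; last exact: inner_mu_laplacian.
  split=> //; first by move=> x /negP; exact: hs.
  by apply: (summable_support us) => x xs; rewrite hs// mulr0 mul0r.
apply: le_ereal_inf_tmp => _ [f [fa fs _] <-].
have fs0 x : x \notin s -> f x = 0 by move=> /negP; exact: fs.
by rewrite (inner_mu_laplacian us fs0) lee_fin capacity_min.
Qed.

End Capacity.

(** * Survival probabilities and the main estimate *)

Definition survival (s : seq V) (n : nat) : V -> R :=
  iter n (killed_op s) (fun x => (x \in s)%:R).

Lemma survival_ge0 s n x : 0 <= survival s n x.
Proof.
elim: n x => [|n IH] x /=; first by rewrite ler0n.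
rewrite /killed_op; case: ifP => // _; apply: sumr_ge0 => y _.
by rewrite mulr_ge0 ?trans_ge0.
Qed.

Lemma survival_out s n x : x \notin s -> survival s n x = 0.
Proof.
by case: n => [|n] /negbTE xs /=; rewrite /killed_op xs.
Qed.

(** As [survival s n x] is the probability that the exit time T exceeds n ([stays_prob]), this is
    the mean of min(T, N), finite even before T is known to be integrable. *)
Definition truncated_exit (s : seq V) (N : nat) x : R :=
  \sum_(0 <= n < N) survival s n x.

(** A truncated form of $-\Delta u = 1$: [killed_op] shifts the index of [survival], so the sum
    telescopes to [survival s 0 x], which is 1 on [s], minus [survival s N x]. *)
Lemma dirichlet_op_truncated_exit s N x : x \in s ->
  dirichlet_op s (truncated_exit s N) x = mass G x * (1 - survival s N x).
Proof.
move=> xs; rewrite dirichlet_opE//; congr (_ * _).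
have -> : killed_op s (truncated_exit s N) x =
    \sum_(0 <= n < N) survival s n.+1 x.
  rewrite /killed_op xs /truncated_exit.
  under eq_bigr do rewrite mulr_sumr.
  by rewrite exchange_big; apply: eq_bigr => n _; rewrite /= /killed_op xs.
rewrite /truncated_exit -sumrB -[RHS]opprB.
have -> : 1 = survival s 0 x by rewrite /survival /= xs.
rewrite -(telescope_sumr (survival s ^~ x))// -sumrN; apply: eq_bigr => n _.
by rewrite opprB.
Qed.

(* For [s] and [a] enumerating B(x,2r) and B(x,r), [U y] is the mean exit time
   from B(x,2r) of the walk started at [y], and [E] is [U x]. *)
Lemma einstein_estimate (s a : seq V) (U : V -> \bar R) (E : \bar R) (C : R) :
  uniq s -> uniq a -> {subset a <= s} -> (exists x, x \in a) -> 0 < C ->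
  (forall x, U x = (\sum_(0 <= n <oo) (survival s n x)%:E)%E) ->
  (forall x, x \in s -> (U x <= C%:E * E)%E) ->
  (forall x, x \in a -> (E <= C%:E * U x)%E) ->
  (0 <= E)%E ->
  exists rho H ex : R, [/\
    resistance G [set` a] (~` [set` s]) = rho%:E, E = ex%:E & [/\ 0 < rho,
    \sum_(x <- a) mass G x <= H <= \sum_(x <- s) mass G x,
    rho * H <= C * ex & ex <= C * (rho * H)]].
Proof.
move=> us ua sub_as a0 C0 UE UCE EUC E0.
have [h [h01 ha hs hharm]] := equilibrium_potential us sub_as.
have rhoE := resistanceE us sub_as h01 ha hs hharm a0.
have cap0 := capacity_gt0 us sub_as h01 ha hs hharm a0.
have [y0 y0a ey0] := equilibrium_charge_gt0 us h01 ha hs hharm a0.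
have e0 := equilibrium_charge_ge0 us h01 ha hharm.
have capE := capacityE ha hharm.
set cap := dirichlet_form s h h in rhoE cap0 capE.
pose H := \sum_(x <- s) h x * mass G x.
have green N : \sum_(x <- s) truncated_exit s N x * dirichlet_op s h x =
    \sum_(x <- s) h x * mass G x * (1 - survival s N x).
  rewrite [LHS](dirichlet_formC s _ h) /dirichlet_form !big_seq.
  by apply: eq_bigr => x xs; rewrite dirichlet_op_truncated_exit// mulrA.
have u0 N x : 0 <= truncated_exit s N x.
  by apply: sumr_ge0 => n _; exact: survival_ge0.
have hm0 x : 0 <= h x * mass G x.
  by rewrite mulr_ge0 ?(ltW (mass_gt0 x))//; case/andP: (h01 x).
(* All terms of the left side of [green] are nonnegative, so each is bounded by [H], uniformly in
   [N]. *)
have uH N x : x \in s -> truncated_exit s N x * dirichlet_op s h x <= H.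
  move=> xs; apply: (@le_trans _ _
    (\sum_(x <- s) truncated_exit s N x * dirichlet_op s h x)).
    rewrite (bigD1_seq x)//= lerDl big_seq_cond.
    by apply: sumr_ge0 => y /andP[ys _]; rewrite mulr_ge0 ?e0.
  rewrite green; apply: ler_sum => y _.
  by rewrite ler_piMr// lerBlDr lerDl survival_ge0.
have Ucvg x : (truncated_exit s N x)%:E @[N --> \oo] --> U x.
  rewrite UE; have -> : (fun N => (truncated_exit s N x)%:E) =
      (fun N => (\sum_(0 <= n < N) (survival s n x)%:E)%E).
    by apply/funext => N; rewrite /truncated_exit -sumEFin.
  by apply: is_cvg_nneseries => n _ _; rewrite lee_fin survival_ge0.
(* Finiteness of exit times starts at [y0], where the charge is positive. It passes to [E] by [EUC],
   then to all of [s] by [UCE]. *)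
have Uy0 : (U y0 <= (H / dirichlet_op s h y0)%:E)%E.
  have <- := cvg_lim (@ereal_hausdorff R) (Ucvg y0).
  apply: lime_le; first by apply/cvg_ex; exists (U y0); exact: Ucvg.
  apply: nearW => N; rewrite lee_fin ler_pdivlMr//; apply: uH; exact: sub_as.
have [ex exE] : exists ex, E = ex%:E.
  case: E E0 EUC {UCE} => [ex _ _|_ EUC|//]; first by exists ex.
  have := EUC _ y0a; move: Uy0; rewrite leye_eq.
  case: (U y0) => [r _|//|_] /eqP //.
  by rewrite mulrNy gtr0_sg// mul1e.
have Ufin x : x \in s -> exists u, U x = u%:E.
  move=> xs; have := UCE x xs; rewrite exE -EFinM.
  have : (0 <= U x)%E.
    by rewrite UE; apply: nneseries_ge0 => n _ _; rewrite lee_fin survival_ge0.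
  by case: (U x) => [u _ _|//|//]; exists u.
pose u x := fine (U x).
have uE x : x \in s -> U x = (u x)%:E by move=> /Ufin[v]; rewrite /u => ->.
have ucvg x : x \in s -> truncated_exit s N x @[N --> \oo] --> u x.
  by move=> xs; have := Ucvg x; rewrite uE// => /fine_cvg.
(* These are the terms of the convergent series with sum [u x]. *)
have surv0 x : x \in s -> survival s N x @[N --> \oo] --> 0.
  move=> xs; apply: (cvg_series_cvg_0 (u_ := fun n => survival s n x)).
  by apply/cvg_ex; exists (u x); exact: ucvg.
(* Both sides of [green] converge as [N] grows, the factor [1 - survival s N x] tending to 1. *)
have uHE : \sum_(x <- s) u x * dirichlet_op s h x = H.
  pose S N := \sum_(x <- s | x \in s) truncated_exit s N x * dirichlet_op s h x.
  apply: (@cvg_unique _ _ (S @ \oo)); first exact: norm_hausdorff.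
    rewrite big_seq; apply: cvg_big => [|x xs]; first exact: add_continuous.
    by apply: cvgMr_tmp; exact: ucvg.
  have -> : S = fun N => \sum_(x <- s | x \in s)
      h x * mass G x * (1 - survival s N x).
    by apply/funext => N; rewrite /S -!big_seq green.
  rewrite /H big_seq; apply: cvg_big => [|x xs]; first exact: add_continuous.
  rewrite -[X in _ --> X]mulr1; apply: cvgMl_tmp.
  by rewrite -[X in _ --> X]subr0; apply: cvgB; [exact: cvg_cst | exact: surv0].
exists cap^-1, H, ex; split=> //; split.
- by rewrite invr_gt0.
- apply/andP; split; last first.
    by apply: ler_sum => x _; rewrite ler_piMl ?(ltW (mass_gt0 x))//; case/andP: (h01 x).
  rewrite /H [leRHS](bigID (mem a))/= -[leLHS]addr0 lerD ?sumr_ge0//.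
  rewrite -[leRHS]big_filter [leRHS](perm_big a) /=; last first.
    apply: uniq_perm; rewrite ?filter_uniq// => x.
    by rewrite mem_filter; case: (boolP (x \in a)) => //= /sub_as.
  by rewrite !big_seq; apply: ler_sum => x xa; rewrite ha ?mul1r.
(* After multiplication by [cap], the total charge, both bounds compare [u] with [ex] under the
   charge; the next one needs this only on [a], which carries the charge. *)
- rewrite mulrC ler_pdivrMr// capE mulr_sumr -uHE !big_seq.
  apply: ler_sum => x xs; rewrite ler_wpM2r ?e0//.
  by rewrite -lee_fin EFinM -uE// -exE; exact: UCE.
- rewrite mulrCA mulrC ler_pdivlMr// capE mulr_sumr -uHE mulr_sumr !big_seq.
  apply: ler_sum => x xs; have [xa|xa] := boolP (x \in a); last first.
    by rewrite hharm// !mulr0.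
  rewrite mulrA ler_wpM2r ?e0//.
  by rewrite -lee_fin EFinM -uE// -exE; exact: EUC.
Qed.

End Dirichlet.

(** * Mean exit times as sums of survival probabilities *)

Section ExitTime.
Variables (R : realType) (V : countType) (G : weighted_graph R V).
Variables (d : measure_display) (Omega : measurableType d).
Variables (P : probability Omega R) (X : nat -> Omega -> V) (x : V).
Variables (p0 : R) (p0_gt0 : 0 < p0).
Hypothesis p0_trans : forall x y, adj G x y -> p0 <= weight G x y / mass G x.
Hypothesis walkX : random_walk_from G P X x.
Implicit Types (A B : set V) (p : nat -> V).

Definition stays A n : set Omega := [set w | forall i, (i <= n)%N -> A (X i w)].

Definition follows p n : set Omega :=
  [set w | forall i, (i <= n)%N -> X i w = p i].

(** The walk is specified by its path probabilities only; fixing an initial path of arbitrary length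
    makes an induction on [m] possible. *)
Definition follows_then_stays p k A m : set Omega :=
  follows p k `&` [set w | forall i, (k < i <= k + m)%N -> A (X i w)].

Lemma measurable_visit A n : finite_set A -> measurable (X n @^-1` A).
Proof.
have [mX _ _] := walkX => finA.
have -> : X n @^-1` A = \bigcup_(y in A) (X n @^-1` [set y]).
  by apply/seteqP; split=> [w Aw|w [y Ay /= ->//]]; exists (X n w).
by apply: fin_bigcup_measurable.
Qed.

Lemma measurable_stays A n : finite_set A -> measurable (stays A n).
Proof.
move=> finA; have -> : stays A n =
    \bigcap_(i in [set i | (i <= n)%N]) (X i @^-1` A).
  by apply/seteqP; split=> w Aw i /= /Aw.
by apply: bigcap_measurableType => i _; exact: measurable_visit.
Qed.

Lemma measurable_follows_then_stays p k A m : finite_set A ->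
  measurable (follows_then_stays p k A m).
Proof.
move=> finA; apply: measurableI.
  have -> : follows p k =
      \bigcap_(i in [set i | (i <= k)%N]) (X i @^-1` [set p i]).
    by apply/seteqP; split=> w Aw i /= /Aw.
  apply: bigcap_measurableType => i _; exact: measurable_visit.
have -> : [set w | forall i, (k < i <= k + m)%N -> A (X i w)] =
    \bigcap_(i in [set i | (k < i <= k + m)%N]) (X i @^-1` A).
  by apply/seteqP; split=> w Aw i /= /Aw.
by apply: bigcap_measurableType => i _; exact: measurable_visit.
Qed.

Lemma measure_split_visit (s : seq V) n (E : set Omega) : uniq s ->
  measurable E -> (forall w, E w -> X n w \in s) ->
  P E = (\sum_(y <- s) P (E `&` X n @^-1` [set y]))%E.
Proof.
move=> us mE Es; rewrite fsbig_seq// -measure_fin_bigcup.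
- congr (P _); apply/seteqP; split=> [w Ew|w [y _ []//]].
  by exists (X n w); [exact: Es|].
- exact: finite_seq.
- by move=> y z _ _ [w [[_ /= <-] [_ /= <-]]].
- by move=> y _; apply: measurableI => //; exact: measurable_visit.
Qed.

(** The Markov property: split according to the position at time [k.+1] and absorb that position
    into the prescribed path. *)
Lemma follows_then_stays_prob (s : seq V) m : uniq s -> forall p k, p k \in s ->
  P (follows_then_stays p k [set` s] m) =
  (P (follows p k) * (survival G s m (p k))%:E)%E.
Proof.
move=> us; elim: m => [|m IH] p k pk.
  rewrite /survival /= pk mule1; congr (P _).
  apply/seteqP; split=> [w []//|w pw]; split=> // i.
  by rewrite addn0 => /andP[]; case: ltngtP.
rewrite (measure_split_visit (n := k.+1) us); first last.
- by move=> w [_]; apply; lia.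
- exact/measurable_follows_then_stays/finite_seq.
rewrite /= /killed_op pk -sumEFin ge0_sume_distrr; last first.
  move=> y _; rewrite lee_fin mulr_ge0//.
    exact: trans_ge0 p0_gt0 p0_trans _ _.
  exact: survival_ge0 p0_gt0 p0_trans _ _ _.
rewrite !big_seq; apply: eq_bigr => y ys.
(* The path [p] redirected to [y] at time [k.+1]; its values up to time [k] are unchanged. *)
pose q i := if i == k.+1 then y else p i.
have qk : q k.+1 = y by rewrite /q eqxx.
have qp i : (i <= k)%N -> q i = p i by rewrite /q; case: eqP => // ->; rewrite ltnn.
have -> : follows_then_stays p k [set` s] m.+1 `&` X k.+1 @^-1` [set y] =
    follows_then_stays q k.+1 [set` s] m.
  apply/seteqP; split=> w.
    move=> [[pw sw] /= wy]; split=> i.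
      by rewrite leq_eqVlt => /predU1P[->|ik]; rewrite ?qk// qp ?pw.
    by move=> ikm; apply: sw; lia.
  move=> [qw sw]; split; last by rewrite /= qw.
  split=> i; first by move=> ik; rewrite qw ?qp//; lia.
  have [->|ik ikm] := eqVneq i k.+1; first by rewrite qw// qk.
  by apply: sw; lia.
rewrite IH qk//; have [_ _ walk] := walkX.
rewrite [P (follows q k.+1)]walk qk qp// -muleA -EFinM.
suff -> : [set w | forall i, (i <= k)%N -> X i w = q i] = follows p k by [].
by apply/seteqP; split=> w qw i ik; rewrite (qw i ik) qp.
Qed.

Lemma stays_prob (s : seq V) n : uniq s ->
  P (stays [set` s] n) = (survival G s n x)%:E.
Proof.
move=> us; have mS := measurable_stays n (finite_seq s).
have [mX P1 _] := walkX; have mX0 := mX 0%N x.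
(* The walk starts at [x] only almost surely, so the exceptional null event is removed first. *)
have -> : P (stays [set` s] n) = P (stays [set` s] n `&` X 0%N @^-1` [set x]).
  rewrite (measureDI P mS mX0) -[RHS]add0e; congr (_ + _)%E.
  apply/eqP; rewrite eq_le measure_ge0 andbT.
  apply: (@le_trans _ _ (P (~` (X 0%N @^-1` [set x])))).
    apply: le_measure; [exact/mem_set/measurableD|exact/mem_set/measurableC|].
    by move=> w [].
  by rewrite probability_setC// [X in (_ - X)%E]P1 subee.
have [xs|xs] := boolP (x \in s); last first.
  rewrite survival_out// [X in P X](_ : _ = set0) ?measure0//.
  by apply/seteqP; split=> // w [/(_ 0%N isT)/= + w0]; rewrite w0 (negbTE xs).
have -> : stays [set` s] n `&` X 0%N @^-1` [set x] =
    follows_then_stays (fun=> x) 0 [set` s] n.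
  apply/seteqP; split=> w.
    move=> [sw w0]; split=> i; first by rewrite leqn0 => /eqP ->.
    by move=> /andP[_ ?]; exact: sw.
  move=> [w0 sw]; split; last exact: w0.
  move=> [_|i ik]; first by rewrite /= w0.
  by apply: sw; lia.
rewrite follows_then_stays_prob// [P _](_ : _ = 1%E) ?mul1e//.
rewrite -P1; congr (P _); apply/seteqP; split=> w; first exact.
by move=> w0 i; rewrite leqn0 => /eqP ->.
Qed.

(** The event [stays A n] says that the exit time exceeds n. If the walk never exits, every
    indicator is 1 and both sides are infinite. *)
Lemma exit_timeE A w :
  exit_time R X A w = (\sum_(0 <= n <oo) (\1_(stays A n) w)%:E)%E.
Proof.
have [exitA|noexit] := pselect (exists k, ~ A (X k w)); last first.
  have in_stays n : \1_(stays A n) w = 1 :> R.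
    rewrite indicE mem_set// => i _; apply: contrapT => nA.
    by apply: noexit; exists i.
  rewrite /exit_time [X in ereal_inf X](_ : _ = set0); last first.
    by apply/seteqP; split=> // t [k nA _]; apply: noexit; exists k.
  rewrite ereal_inf0 (eq_eseriesr (g := fun=> 1%E)) => [|n _]; last first.
    by rewrite in_stays.
  have ge N : (N%:R%:E <= \sum_(0 <= n <oo) (1 : \bar R))%E.
    apply: le_trans (nneseries_lim_ge (u_ := fun=> 1%E) (P := xpredT) N _) => //.
    by rewrite sumEFin sumr_const_nat subn0.
  case: (\sum_(0 <= n <oo) _)%E ge => [r ge|//|/(_ 0%N)//].
  by have := ge (Num.truncn r).+1; rewrite lee_fin leNgt truncnS_gt.
have exitb : exists k, `[< ~ A (X k w) >].
  by have [k kA] := exitA; exists k; apply/asboolP.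
have [k /asboolP kA kmin] := ex_minnP exitb.
have stE n : \1_(stays A n) w = (n < k)%:R :> R.
  rewrite indicE; case: ltnP => nk; last by rewrite memNset// => /(_ _ nk).
  rewrite mem_set// => i ik; apply: contrapT => nA.
  by have := kmin i (asboolT nA); rewrite leqNgt (leq_ltn_trans ik nk).
rewrite (nneseries_split 0 k) => [|n _]; last by rewrite lee_fin stE.
rewrite add0n eseries0 => [|n kn _]; last by rewrite stE ltnNge kn.
rewrite adde0 (eq_big_nat _ _ (F2 := fun=> 1%E)) => [|n /andP[_ nk]]; last first.
  by rewrite stE nk.
rewrite sumEFin sumr_const_nat subn0.
apply/eqP; rewrite eq_le; apply/andP; split.
  by apply: ereal_inf_lbound; exists k.
apply: le_ereal_inf_tmp => _ [j jA <-]; rewrite lee_fin ler_nat.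
by apply: kmin; apply/asboolP.
Qed.

(** The tail-sum formula for an expectation, by exchanging the integral with a series of nonnegative
    terms. *)
Lemma mean_exit_stays A : finite_set A ->
  (\int[P]_(w in [set: Omega]) exit_time R X A w)%E =
  (\sum_(0 <= n <oo) P (stays A n))%E.
Proof.
move=> finA; have mS n := measurable_stays n finA.
under eq_integral do rewrite exit_timeE.
rewrite integral_nneseries//.
- by apply: eq_eseriesr => n _; rewrite integral_indic ?setIT.
- by move=> n; apply/measurable_EFinP; exact: measurable_indic.
Qed.

Lemma mean_exit_survival A (s : seq V) : A = [set` s] -> uniq s ->
  (\int[P]_(w in [set: Omega]) exit_time R X A w)%E =
  (\sum_(0 <= n <oo) (survival G s n x)%:E)%E.
Proof.
move=> -> us; rewrite mean_exit_stays; last exact: finite_seq.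
by apply: eq_eseriesr => n _; exact: stays_prob.
Qed.

Lemma mean_exit_le A B : finite_set B -> A `<=` B ->
  (\int[P]_(w in [set: Omega]) exit_time R X A w <=
   \int[P]_(w in [set: Omega]) exit_time R X B w)%E.
Proof.
move=> finB AB; have finA := sub_finite_set AB finB.
rewrite !mean_exit_stays//; apply: lee_nneseries => // n _.
apply: le_measure; [exact/mem_set/measurable_stays..|].
by move=> w sA i /sA/AB.
Qed.

End ExitTime.

(* For r <= 1/2 both B(x,r) and B(x,2r) are reduced to x, so v(x,r,2r) = 0 < E(x,2r):
   the relation only makes sense for r > 1/2, which includes every integer r >= 1. *)
Theorem theorem3p9 (R : realType) (V : countType) (G : weighted_graph R V)
    (d : measure_display) (Omega : measurableType d)
    (Pr : V -> probability Omega R) (X : nat -> Omega -> V)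
    (walkX : forall x : V, random_walk_from G (Pr x) X x)
    (p0G : cond_p0 G) (VDG : cond_VD G) (TCG : cond_TC G Pr X) :
  exists C : R, 1 < C /\
    forall (x : V) (r : R), 2^-1 < r ->
      (C^-1%:E * (annulus_resistance G x r (2 * r) * annulus_vol G x r (2 * r))
         <= mean_exit_time G Pr X x (2 * r))%E /\
      (mean_exit_time G Pr X x (2 * r)
         <= C%:E * (annulus_resistance G x r (2 * r) * annulus_vol G x r (2 * r)))%E.
Proof.
have [p0 [p0_gt0 p0_trans]] := p0G.
have [D [D0 VD]] := VDG; have [K [K1 TC]] := TCG.
have K0 : 0 < K by exact: lt_trans K1.
have D40 : 0 < D ^+ 4 by rewrite exprn_gt0.
have KD : 0 < K * D by rewrite mulr_gt0.
have KD4 : 0 < K * D ^+ 4 by rewrite mulr_gt0.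
(* The lower bound uses [K * D], the upper bound [K * D ^+ 4]; the 1 makes the constant exceed 1. *)
exists (1 + K * D + K * D ^+ 4); split; first by lra.
move=> x r r2; have r0 : 0 < r by lra.
have [s [us sE]] := gball_seq p0_gt0 p0_trans x (2 * r).
have [a [ua aE]] := gball_seq p0_gt0 p0_trans x r.
have vols := vol_seq p0_gt0 p0_trans sE us.
have vola := vol_seq p0_gt0 p0_trans aE ua.
have sub_as : {subset a <= s}.
  have : gball G x r `<=` gball G x (2 * r) by apply: sub_gball; lra.
  by rewrite aE sE.
have xa : x \in a.
  by have := gball_center G x r0; rewrite aE.
pose U y : \bar R := (\int[Pr y]_(w in [set: Omega])
  exit_time R X (gball G x (2 * r)) w)%E.
pose E := mean_exit_time G Pr X x (2 * r).
have finB y t := finite_gball p0_gt0 p0_trans y t.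
have UE y : U y = (\sum_(0 <= n <oo) (survival G s n y)%:E)%E.
  by rewrite /U (mean_exit_survival p0_gt0 p0_trans (walkX y) sE us).
(* B(x,2r) lies in B(y,4r), and (TC) at [y] with radius 2r bounds E(y,4r) by [K] E(x,2r). *)
have UCE y : y \in s -> (U y <= K%:E * E)%E.
  move=> ys; have xy : gball G y (2 * r) x by apply: gball_sym; rewrite sE.
  apply: le_trans (TC _ _ _ _ xy); last by lra.
  apply: (mean_exit_le (walkX y)) => //.
  by move=> z /(gball_triangle xy); rewrite [in X in _ -> X]mulr_natl mulr2n.
(* (TC) at [x] with radius r bounds E(x,2r) by [K] E(y,r), and B(y,r) lies in B(x,2r). *)
have EUC y : y \in a -> (E <= K%:E * U y)%E.
  move=> ya; have xy : gball G x r y by rewrite aE.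
  apply: le_trans (TC _ _ r0 _ xy) _.
  rewrite lee_pmul2l ?fin_numE ?lte_fin//.
  apply: (mean_exit_le (walkX y)) => //.
  by move=> z /(gball_triangle xy); rewrite [in X in _ -> X]mulr_natl mulr2n.
have E0 : (0 <= E)%E.
  rewrite [E]UE; apply: nneseries_ge0 => n _ _.
  by rewrite lee_fin (survival_ge0 p0_gt0 p0_trans).
have [rho [H [ex [rhoE exE [rho0 /andP[H1 H2] rH exH]]]]] :=
  einstein_estimate p0_gt0 p0_trans us ua sub_as (ex_intro _ x xa) K0
    UE UCE EUC E0.
have V2V1 := VD x r r0; have V2v := vol_le_annulus p0_gt0 p0_trans D0 VD x r2.
rewrite /annulus_vol vols vola -!EFinB -!EFinM !lee_fin in V2V1 V2v.
rewrite -/E exE /annulus_resistance /annulus_vol sE aE rhoE vols vola.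
rewrite -EFinB -!EFinM !lee_fin.
have V1_ge0 : 0 <= \sum_(y <- a) mass G y.
  by apply: sumr_ge0 => y _; rewrite ltW ?(mass_gt0 p0_gt0 p0_trans).
have V1V2 : \sum_(y <- a) mass G y <= \sum_(y <- s) mass G y by exact: le_trans H2.
move: (\sum_(y <- a) _) (\sum_(y <- s) _) {rhoE vols vola} V1_ge0 V1V2 H1 H2 V2V1 V2v.
move=> V1 V2 V1_ge0 V1V2 H1 H2 V2V1 V2v.
have v0 : 0 <= V2 - V1 by lra.
have q0 : 0 <= rho * (V2 - V1) by rewrite mulr_ge0// ltW.
have ex0 : 0 <= ex by rewrite -lee_fin -exE.
split.
  rewrite mulrC ler_pdivrMr; last by lra.
  (* Here V2 - V1 <= V2 <= D V1 <= D H, by doubling. *)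
  have : rho * (V2 - V1) <= D * (K * ex).
    apply: (@le_trans _ _ (D * (rho * H))); last by rewrite ler_pM2l.
    by rewrite mulrCA ler_pM2l//; nra.
  by nra.
apply: (le_trans exH).
(* Here H <= V2, which the annulus volume controls by [V2v]. *)
have : rho * H <= D ^+ 4 * (rho * (V2 - V1)).
  by rewrite mulrCA ler_pM2l//; exact: le_trans V2v.
by nra.
Qed.
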